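(* Given a null sequence $(x_k)_{k\ge 1}$ of real numbers (that is, $x_k\to 0$), let $X^{+}$ (respectively $X^{-}$) be the (possibly infinite) sum of all the positive (respectively negative) terms. Then the subsum set $\Sigma$ of $(x_k)$ is a closed, perfect set whose convex hull is the interval $[X^{-},X^{+}]$, and which is symmetric with respect to reflection across the midpoint of this interval. Furthermore, denote the sequence of absolute values of the terms by $a_k=|x_k|$, $k=1,2,\dots$, where the terms are indexed so that $a_{k+1}\le a_k$ for all $k$, and denote its tails by $A_k=\sum_{i>k}a_i$. Then: (1) If the tail bounds the term, $a_k\le A_k$, for all $k>K$, and the number of terms which exceed the tail, $a_k>A_k$, is $N$, then $\Sigma$ is the union of between $2^{N}$ and $2^{K}$ disjoint closed intervals. (2) If the term exceeds the tail ($a_k>A_k$) infinitely often, then $\Sigma$ is either a Cantor set or a symmetric Cantorval. In particular, if the term always exceeds the tail ($a_k>A_k$ for every $k$), then $\Sigma$ is a Cantor set.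
   Context: The subsum set $\Sigma$ of a real sequence $(x_k)_{k\ge1}$ converging to $0$ is the set of all numbers $\sum_{k=1}^{\infty}\xi_k x_k$, where $(\xi_k)_{k\ge 1}$ is any sequence of zeroes and ones for which this series converges (so sums of infinite, finite, and empty subsequences are included, the empty sum being $0$). Closed interval notation is allowed with one or both endpoints infinite: in such a case the square bracket at that end is to be replaced by a round parenthesis, so ''closed intervals'' may be unbounded. If $\sum_k a_k=\infty$, then every tail $A_k$ is infinite and is regarded as bounding every term, so $a_k\le A_k$ for every $k$. A set is perfect if it is closed and has no isolated points. A Cantor set is a nonempty compact subset of $\mathbb{R}$ that is perfect and totally disconnected. A component of a subset of $\mathbb{R}$ is trivial if it is a single point and nontrivial otherwise. A symmetric Cantorval is a nonempty compact subset $\mathcal{S}\subset\mathbb{R}$ such that (i) $\mathcal{S}$ is the closure of its interior, and (ii) both endpoints of any nontrivial component of $\mathcal{S}$ are accumulation points of trivial (one-point) components of $\mathcal{S}$.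
   Formalization: That Σ is perfect is claimed only when infinitely many terms are nonzero: otherwise Σ is a finite nonempty set (for example {0} for the zero sequence) and has isolated points; correspondingly, the closed intervals in (1) may be single points. *)

(* Defs.v *)
From HB Require Import structures.
From mathcomp Require Import all_boot all_order all_algebra.
From mathcomp Require Import all_classical all_reals all_analysis.
Set Implicit Arguments.
Unset Strict Implicit.
Unset Printing Implicit Defensive.
Import Order.TTheory GRing.Theory Num.Theory.
Import numFieldNormedType.Exports.
Local Open Scope classical_set_scope.
Local Open Scope ring_scope.

(* Sequences are indexed from 0: the k-th term of a sequence indexed from 1
   is [x k.-1].  Thus "for all k > K" (1-based) becomes [forall k, K <= k]. *)

(* Convergence is convergence of the partial sums in the given order; it is
   not required to be absolute. *)
Definition subsum_set (R : realType) (x : R^nat) : set R :=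
  [set s | exists xi : nat -> bool,
    series (fun k => (xi k)%:R * x k) @ \oo --> s].

Definition pos_sum (R : realType) (x : R^nat) : \bar R :=
  (\sum_(0 <= k <oo | (0 < x k)%R) (x k)%:E)%E.

Definition neg_sum (R : realType) (x : R^nat) : \bar R :=
  (\sum_(0 <= k <oo | (x k < 0)%R) (x k)%:E)%E.

(* An infinite endpoint is automatically excluded, since [y] is real. *)
Definition closed_itv (R : realType) (lo hi : \bar R) : set R :=
  [set y | (lo <= y%:E <= hi)%E].

Definition convex_hull (R : realType) (A : set R) : set R :=
  smallest (@convex_set R R^o) A.

(* [c] is equidistant from both endpoints.  For finite [lo] and [hi] this means
   c = (lo + hi) / 2; a half-line has no midpoint, and every real number is a
   midpoint of the whole line. *)
Definition is_midpoint (R : realType) (lo hi : \bar R) (c : R) : Prop :=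
  (c%:E - lo = hi - c%:E)%E.

Definition reflection_symmetric (R : realType) (c : R) (A : set R) : Prop :=
  [set c + c - y | y in A] = A.

(* [sigma] lists the terms of [x] without repetition, in some order; it may
   skip zero terms (it has to, for a nonincreasing listing of the absolute
   values, if [x] has infinitely many nonzero terms and a zero term). *)
Definition term_indexing (R : realType) (x : R^nat) (sigma : nat -> nat) :
    Prop :=
  injective sigma /\ [set k | x k != 0] `<=` range sigma.

Definition abs_terms (R : realType) (x : R^nat) (sigma : nat -> nat) : R^nat :=
  fun k => `|x (sigma k)|.

Definition tail (R : realType) (a : R^nat) (k : nat) : \bar R :=
  (\sum_(k.+1 <= i <oo) (a i)%:E)%E.

Definition exceeding (R : realType) (a : R^nat) : set nat :=
  [set k | (tail a k < (a k)%:E)%E].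

Definition union_of_closed_itvs (R : realType) (A : set R) (n : nat) : Prop :=
  exists lo hi : nat -> \bar R,
    [/\ forall i, (i < n)%N -> closed_itv (lo i) (hi i) !=set0,
        trivIset `I_n (fun i => closed_itv (lo i) (hi i)) &
        A = \bigcup_(i in `I_n) closed_itv (lo i) (hi i)].

Definition Cantor_set (R : realType) (A : set R) : Prop :=
  [/\ A !=set0, compact A, perfect_set A & totally_disconnected A].

Definition trivial_points (R : realType) (A : set R) : set R :=
  [set y | A y /\ connected_component A y = [set y]].

(* The components of a compact set of reals are compact intervals, so that the
   endpoints of a component are its infimum and its supremum. *)
Definition symmetric_Cantorval (R : realType) (A : set R) : Prop :=
  [/\ A !=set0, compact A, A = closure (interior A) &
      forall y, A y -> connected_component A y <> [set y] ->
        limit_point (trivial_points A) (inf (connected_component A y)) /\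
        limit_point (trivial_points A) (sup (connected_component A y))].

(* Main.v *)
Require Import Defs.
From HB Require Import structures.
From mathcomp Require Import all_boot all_order all_algebra.
From mathcomp Require Import all_classical all_reals all_analysis.
From mathcomp Require Import finmap ring lra zify.
Set Implicit Arguments.
Unset Strict Implicit.
Unset Printing Implicit Defensive.
Import Order.TTheory GRing.Theory Num.Theory.
Import numFieldNormedType.Exports.
Local Open Scope classical_set_scope.
Local Open Scope ring_scope.

(** If the positive or the negative terms have an infinite sum, greedy selection
    reaches every real number between [X^-] and [X^+].  Otherwise, swapping the
    choice made for the negative terms turns the subsum set of [x] into a
    translate by [X^-] of the subsum set [E] of the absolute values [a], which
    does not depend on their order.  Let [T_k] be the subsum set of the terms of
    index at least [k] and [r_k] its maximum; then [T_k] is the union of [T_(k+1)]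
    and [a_k + T_(k+1)], and [E] is the union of the translates [f + T_k] by the
    finite sums [f] of the first [k] terms.

    If [a_k <= r_(k+1)] for [k >= K], then [T_K] is an interval, so [E] is a union
    of [2^K] intervals.  If [a_k > r_(k+1)], then for each [i <= k] both ends of
    [T_i] are copies of [T_(k+1)], at both sides of a gap; hence each such term
    doubles the number of intervals.

    If [a_k > r_(k+1)] infinitely often, then every [T_k] has gaps arbitrarily near
    0.  A right endpoint of a gap of [E] is a finite sum, above which [E] looks like
    some [T_k]; hence it is a trivial component, and by symmetry so is a left
    endpoint.  Gaps accumulate at the endpoints of a nontrivial component.  If there
    is such a component, each [T_k] contains a segment, so [E] is the closure of its
    interior. *)

(** * Convergent real series *)

Lemma series_eqfun (R : realType) (u v : R^nat) : u =1 v -> series u = series v.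
Proof. by move=> uv; congr series; apply/funext. Qed.

Lemma cvg_series_add (R : realType) (u v w : R^nat) (a b : R) :
  series u @ \oo --> a -> series v @ \oo --> b ->
  (forall k, w k = u k + v k) -> series w @ \oo --> a + b.
Proof.
move=> ua vb wE; rewrite (series_eqfun (v := u + v) wE) seriesD.
exact: cvgD.
Qed.

Lemma cvg_series_sub (R : realType) (u v w : R^nat) (a b : R) :
  series u @ \oo --> a -> series v @ \oo --> b ->
  (forall k, w k = u k - v k) -> series w @ \oo --> a - b.
Proof.
move=> ua vb wE; rewrite (series_eqfun (v := u - v) wE) seriesD seriesN.
exact: cvgB.
Qed.

Lemma cvg_series_single (R : realType) (k : nat) (c : R) :
  series (fun i => (i == k)%:R * c) @ \oo --> c.
Proof.
apply: cvg_near_cst; exists k.+1 => // n /= kn.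
rewrite /series /= (bigD1_seq k) ?iota_uniq ?mem_index_iota //=.
rewrite eqxx mul1r big1 ?addr0 // => i /negbTE ->; exact: mul0r.
Qed.

Lemma nonneg_series_ge0 (R : realType) (u : R^nat) (a : R) :
  (forall k, 0 <= u k) -> series u @ \oo --> a -> 0 <= a.
Proof.
move=> u0 ua; apply: (@closed_cvg _ _ _ _ (series u) (fun y => 0 <= y)) ua.
  exact: closed_ge.
by near=> n; rewrite /series /=; apply: sumr_ge0.
Unshelve. all: end_near. Qed.

Lemma cvg_series_le (R : realType) (u v : R^nat) (a b : R) :
  (forall k, u k <= v k) ->
  series u @ \oo --> a -> series v @ \oo --> b -> a <= b.
Proof.
move=> uv ua vb; rewrite -subr_ge0.
apply: (@nonneg_series_ge0 _ (fun k => v k - u k)) => [k|].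
  by rewrite subr_ge0.
exact: cvg_series_sub vb ua _.
Qed.

Lemma nonneg_series_cvg_le (R : realType) (u v : R^nat) (b : R) :
  (forall k, 0 <= u k <= v k) -> series v @ \oo --> b -> cvgn (series u).
Proof.
move=> uv vb; apply: (@series_le_cvg _ u v).
- by move=> k; case/andP: (uv k).
- by move=> k; case/andP: (uv k); apply: le_trans.
- by move=> k; case/andP: (uv k).
- by apply/cvg_ex; exists b.
Qed.

(** * Elementary operations on subsum sets; absence of isolated points *)

Lemma subsum0 (R : realType) (x : R^nat) : subsum_set x 0.
Proof.
exists (fun=> false); rewrite (series_eqfun (v := fun=> 0)).
  by apply: cvg_near_cst; near=> n; rewrite /series /= big1.
by move=> k; rewrite mul0r.
Unshelve. all: end_near. Qed.

Lemma subsum_total (R : realType) (x : R^nat) (s : R) :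
  series x @ \oo --> s -> subsum_set x s.
Proof.
move=> xs; exists (fun=> true); rewrite (series_eqfun (v := x)) // => k.
by rewrite mul1r.
Qed.

Lemma subsum_refl (R : realType) (x : R^nat) (s y : R) :
  series x @ \oo --> s -> subsum_set x y -> subsum_set x (s - y).
Proof.
move=> xs [xi xiy]; exists (fun k => ~~ xi k).
apply: cvg_series_sub xs xiy _ => k.
by case: (xi k); rewrite /= ?mul1r ?mul0r ?subrr ?subr0.
Qed.

Lemma subsum_bounds (R : realType) (b : R^nat) (B y : R) :
  (forall k, 0 <= b k) -> series b @ \oo --> B -> subsum_set b y ->
  0 <= y <= B.
Proof.
move=> b0 bB [xi xiy]; apply/andP; split.
  by apply: nonneg_series_ge0 xiy => k; rewrite mulr_ge0.
apply: cvg_series_le xiy bB => k.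
by case: (xi k); rewrite ?mul1r ?mul0r.
Qed.

Lemma subsum_flip (R : realType) (x : R^nat) (k : nat) (y : R) :
  subsum_set x y -> subsum_set x (y + x k) \/ subsum_set x (y - x k).
Proof.
move=> [xi xiy]; have xk := @cvg_series_single R k (x k).
case xik : (xi k); [right|left].
  exists (fun i => (i != k) && xi i); apply: cvg_series_sub xiy xk _ => i.
  by case: eqP => [->|_] /=; rewrite ?xik ?subrr ?mul0r ?subr0.
exists (fun i => (i == k) || xi i); apply: cvg_series_add xiy xk _ => i.
by case: eqP => [->|_] /=; rewrite ?xik ?mul0r ?add0r ?addr0.
Qed.

(** Toggling the choice made for a nonzero term smaller than [e] moves [y] to a different subsum
    within [e]. *)
Lemma subsum_perfect (R : realType) (x : R^nat) :
  x @ \oo --> (0 : R) -> infinite_set [set k | x k != 0] ->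
  closed (subsum_set x) -> perfect_set (subsum_set x).
Proof.
move=> x0 xinf xcl; split => //; apply/seteqP; split.
  move=> y yl; apply: xcl => U /yl [z [_ xz Uz]]; by exists z.
move=> y xy U /nbhs_ballP [e /= e0 eU].
have [n _ nx] : \forall n \near \oo, `|x n| < e.
  by move/cvgrPdist_lt : x0 => /(_ e e0); apply: filterS => n; rewrite sub0r normrN.
have [k [nk xk0]] : exists k, (n <= k)%N /\ x k != 0.
  apply: contrapT => H; apply: xinf; apply: (sub_finite_set (B := `I_n)).
    move=> k /= xk; rewrite ltnNge; apply/negP => nk; apply: H; by exists k.
  exact: finite_II.
have xke := nx k nk.
case: (subsum_flip k xy) => ?; [exists (y + x k)|exists (y - x k)]; split => //.
- by rewrite -subr_eq0 addrAC subrr add0r.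
- by apply: eU; rewrite /ball /= opprD addrA subrr add0r normrN.
- by rewrite -subr_eq0 addrAC subrr add0r oppr_eq0.
- by apply: eU; rewrite /ball /= opprB addrCA subrr addr0.
Qed.

(** * Tails and remainders *)

(** The first [k] terms are zeroed rather than shifted away, so that all tails share the same
    indices and selections. *)
Definition tail_terms (R : realType) (b : R^nat) (k : nat) : R^nat :=
  fun i => if (k <= i)%N then b i else 0.

Lemma tail_terms_ge0 (R : realType) (b : R^nat) (k : nat) :
  (forall i, 0 <= b i) -> forall i, 0 <= tail_terms b k i.
Proof. by move=> b0 i; rewrite /tail_terms; case: ifP. Qed.

Lemma tail_terms0 (R : realType) (b : R^nat) : tail_terms b 0 = b.
Proof. by []. Qed.

Lemma tail_termsS (R : realType) (b : R^nat) (k i : nat) :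
  tail_terms b k i = tail_terms b k.+1 i + (i == k)%:R * b k.
Proof.
rewrite /tail_terms; case: (ltngtP k i) => [ki|ik|->].
- by rewrite mul0r addr0.
- by rewrite mul0r addr0.
- by rewrite mul1r add0r.
Qed.

Lemma tail_terms_nested (R : realType) (b : R^nat) (j k : nat) :
  (j <= k)%N -> tail_terms (tail_terms b j) k = tail_terms b k.
Proof.
move=> jk; apply/funext => i; rewrite /tail_terms.
by case: ifP => // ki; rewrite (leq_trans jk ki).
Qed.

(** When [series b] tends to [B], this is the sum of the terms of index at least [k]; the tail after
    the term [b k] is thus the remainder at [k.+1]. *)
Definition remainder (R : realType) (b : R^nat) (B : R) (k : nat) : R :=
  B - series b k.

Lemma remainder0 (R : realType) (b : R^nat) (B : R) : remainder b B 0 = B.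
Proof. by rewrite /remainder /series /= big_geq // subr0. Qed.

Lemma remainderS (R : realType) (b : R^nat) (B : R) (k : nat) :
  remainder b B k = b k + remainder b B k.+1.
Proof. by rewrite /remainder /series /= big_nat_recr //=; ring. Qed.

Lemma cvg_tail_terms (R : realType) (b : R^nat) (B : R) (k : nat) :
  series b @ \oo --> B -> series (tail_terms b k) @ \oo --> remainder b B k.
Proof.
move=> bB; elim: k => [|k IHk]; first by rewrite remainder0.
have -> : remainder b B k.+1 = remainder b B k - b k.
  by rewrite (remainderS b B k); ring.
apply: cvg_series_sub IHk (@cvg_series_single _ k (b k)) _ => i.
by rewrite (tail_termsS b k) addrK.
Qed.

Lemma remainder_nested (R : realType) (b : R^nat) (B : R) (j k : nat) :
  (j <= k)%N -> series b @ \oo --> B ->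
  remainder (tail_terms b j) (remainder b B j) k = remainder b B k.
Proof.
move=> jk bB; have := cvg_tail_terms (k := k) (cvg_tail_terms (k := j) bB).
rewrite tail_terms_nested // => H.
exact: (cvg_unique (@Rhausdorff R) H (cvg_tail_terms (k := k) bB)).
Qed.

Lemma remainder_ge0 (R : realType) (b : R^nat) (B : R) (k : nat) :
  (forall i, 0 <= b i) -> series b @ \oo --> B -> 0 <= remainder b B k.
Proof.
move=> b0 bB; exact: nonneg_series_ge0 (tail_terms_ge0 k b0) (cvg_tail_terms bB).
Qed.

Lemma cvg_remainder (R : realType) (b : R^nat) (B : R) :
  series b @ \oo --> B -> remainder b B @ \oo --> (0 : R).
Proof.
move=> bB; rewrite -(subrr B); apply: cvgB bB; exact: cvg_cst.
Qed.

Lemma remainder_lt (R : realType) (b : R^nat) (B e : R) : 0 < e ->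
  series b @ \oo --> B -> \forall k \near \oo, remainder b B k < e.
Proof.
move=> e0 /cvg_remainder /cvgrPdist_lt /(_ e e0); apply: filterS => k.
by rewrite sub0r normrN; apply: le_lt_trans; exact: ler_norm.
Qed.

(** * Digit expansions: closedness and the interval criterion *)

Lemma tail_subsum_step (R : realType) (b : R^nat) (k : nat) (y : R) :
  subsum_set (tail_terms b k) y <->
  subsum_set (tail_terms b k.+1) y \/ subsum_set (tail_terms b k.+1) (y - b k).
Proof.
have bk := @cvg_series_single _ k (b k).
split=> [[xi xiy]|[[xi xiy]|[xi xiy]]].
- case xik : (xi k); [right|left]; exists xi.
    apply: cvg_series_sub xiy bk _ => i; rewrite (tail_termsS b k).
    by case: eqP => [->|_]; rewrite ?xik /=; ring.
  rewrite -(series_eqfun (u := fun i => (xi i)%:R * tail_terms b k i)) // => i.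
  rewrite (tail_termsS b k); case: eqP => [->|_]; rewrite ?xik /=; ring.
(* [tail_terms b k.+1] vanishes at [k] and leaves that choice open; here it has to be [false]. *)
- exists (fun i => (i != k) && xi i).
  rewrite (series_eqfun (v := fun i => (xi i)%:R * tail_terms b k.+1 i)) // => i.
  rewrite (tail_termsS b k); case: eqP => [->|_] /=; last by rewrite mul0r addr0.
  by rewrite /tail_terms ltnn mul0r mulr0.
- exists (fun i => (i == k) || xi i); rewrite -(subrK (b k) y).
  apply: cvg_series_add xiy bk _ => i.
  rewrite (tail_termsS b k); case: eqP => [->|_] /=; last by rewrite mul0r !addr0.
  by rewrite /tail_terms ltnn; ring.
Qed.

(* [branch C b y k] is the part of [y] that remains to be represented by the
   terms of index at least [k]: the term [b k] is used only when it must be. *)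
Fixpoint branch (R : realType) (C : nat -> set R) (b : R^nat) (y : R) (k : nat)
    : R :=
  if k is k'.+1 then
    if `[< C k (branch C b y k') >] then branch C b y k'
    else branch C b y k' - b k'
  else y.

(** The sets [C k] are an invariant: what remains of [y] stays in [C k], hence between 0 and [r k],
    and so tends to 0. *)
Lemma branch_subsum (R : realType) (C : nat -> set R) (b r : R^nat) (y : R) :
  r @ \oo --> (0 : R) -> (forall k z, C k z -> 0 <= z <= r k) ->
  (forall k z, C k z -> C k.+1 z \/ C k.+1 (z - b k)) ->
  C 0%N y -> subsum_set b y.
Proof.
move=> r0 Cr CS C0.
have Cb k : C k (branch C b y k).
  elim: k => [//|k IHk] /=; case: asboolP => // nC.
  by case: (CS _ _ IHk).
exists (fun k => ~~ `[< C k.+1 (branch C b y k) >]).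
have -> : series (fun k => (~~ `[< C k.+1 (branch C b y k) >])%:R * b k) =
    (fun k => y - branch C b y k).
  apply/funext => n; rewrite /series /=; elim: n => [|n IHn].
    by rewrite big_geq //= subrr.
  by rewrite big_nat_recr //= IHn; case: asboolP => /= _; ring.
rewrite -{3}(subr0 y); apply: cvgB; first exact: cvg_cst.
apply: (squeeze_cvgr _ (cvg_cst 0) r0).
by near=> n; apply: Cr.
Unshelve. all: end_near. Qed.

Lemma closure_translate (R : realType) (A : set R) (c y : R) :
  closure [set z | A (z - c)] y -> closure A (y - c).
Proof.
move=> Ay U /nbhs_ballP [e /= e0 eU].
have [z [/= Az yz]] := Ay _ (nbhsx_ballx y e e0).
exists (z - c); split=> //; apply: eU.
by move: yz; rewrite /ball /=; congr (`|_| < _); ring.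
Qed.

Lemma closure_itv (R : realType) (A : set R) (lo hi y : R) :
  (forall z, A z -> lo <= z <= hi) -> closure A y -> lo <= y <= hi.
Proof.
move=> AB Ay; have cl : closed [set` `[lo, hi]] by exact: interval_closed.
have /closure_subset /(_ _ Ay) : A `<=` [set` `[lo, hi]].
  by move=> z /AB; rewrite /= in_itv.
by rewrite -(closure_id _).1 //= in_itv.
Qed.

(** Closure commutes with finite unions and translations, so the closures of the tail subsum sets
    obey the same recursion as the sets themselves; a point of the closure therefore gets its digits
    by [branch]. *)
Lemma subsum_closed (R : realType) (b : R^nat) (B : R) :
  (forall k, 0 <= b k) -> series b @ \oo --> B -> closed (subsum_set b).
Proof.
move=> b0 bB y yc.
apply: (@branch_subsum _ (fun k => closure (subsum_set (tail_terms b k)))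
  b (remainder b B)) => //.
- exact: cvg_remainder.
- move=> k z; apply: closure_itv => {}z.
  exact: subsum_bounds (tail_terms_ge0 k b0) (cvg_tail_terms bB).
- move=> k z.
  have -> : subsum_set (tail_terms b k) = subsum_set (tail_terms b k.+1) `|`
      [set z | subsum_set (tail_terms b k.+1) (z - b k)].
    by apply/seteqP; split => w /tail_subsum_step.
  by rewrite closureU => -[|/closure_translate]; [left|right].
Qed.

(* Kakeya: if every term is at most its tail, then for [r k.+1 < z <= r k] the
   term [b k] can be subtracted. *)
Lemma subsum_full (R : realType) (b : R^nat) (B y : R) :
  (forall k, 0 <= b k) -> series b @ \oo --> B ->
  (forall k, b k <= remainder b B k.+1) ->
  0 <= y <= B -> subsum_set b y.
Proof.
move=> b0 bB br yB.
apply: (@branch_subsum _ (fun k => [set z | 0 <= z <= remainder b B k])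
  b (remainder b B)) => //.
- exact: cvg_remainder.
- move=> k z /=; case: (leP z (remainder b B k.+1)) => zr /andP[z0 zk].
    by left; rewrite z0.
  by right; move: (br k) zk; rewrite (remainderS b B k) => ? ?; apply/andP; split; lra.
- by rewrite /= remainder0.
Qed.

Lemma tail_subsum_full (R : realType) (b : R^nat) (B : R) (K : nat) :
  (forall k, 0 <= b k) -> series b @ \oo --> B ->
  (forall k, (K <= k)%N -> b k <= remainder b B k.+1) ->
  forall y, 0 <= y <= remainder b B K -> subsum_set (tail_terms b K) y.
Proof.
move=> b0 bB br y; apply: subsum_full (tail_terms_ge0 K b0) (cvg_tail_terms bB) _.
move=> k; case: (leqP K k) => kK.
  rewrite remainder_nested //; last exact: leqW.
  by rewrite {1}/tail_terms kK br.
(* Below [K] the terms of the tail are 0, hence at most any remainder. *)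
rewrite {1}/tail_terms leqNgt kK /=.
exact: remainder_ge0 (tail_terms_ge0 K b0) (cvg_tail_terms bB).
Qed.

(** * Finite sums and translates of tails *)

(** Repetitions are kept, so that the length is exactly [2 ^ k] and positions can index
    intervals. *)
Fixpoint partial_sums (R : realType) (b : R^nat) (k : nat) : seq R :=
  if k is k'.+1 then
    partial_sums b k' ++ [seq f + b k' | f <- partial_sums b k']
  else [:: 0].

Lemma size_partial_sums (R : realType) (b : R^nat) (k : nat) :
  size (partial_sums b k) = (2 ^ k)%N.
Proof. by elim: k => //= k IHk; rewrite size_cat size_map IHk expnS mul2n addnn. Qed.

Lemma subsum_split (R : realType) (b : R^nat) (k : nat) (y : R) :
  subsum_set b y <->
  exists2 f, f \in partial_sums b k & subsum_set (tail_terms b k) (y - f).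
Proof.
elim: k => [|k IHk].
  rewrite tail_terms0; split=> [yb|[f]]; first by exists 0; rewrite ?subr0 ?inE.
  by rewrite inE => /eqP ->; rewrite subr0.
rewrite IHk; split => -[f fF] /=.
  move=> /tail_subsum_step [fy|fy].
    by exists f; rewrite // mem_cat fF.
  exists (f + b k); rewrite ?opprD ?addrA // mem_cat; apply/orP; right.
  by apply/mapP; exists f.
move: fF; rewrite mem_cat => /orP [fF fy|/mapP [g gF ->] gy].
  by exists f => //; apply/tail_subsum_step; left.
exists g => //; apply/tail_subsum_step; right; move: gy; congr subsum_set; ring.
Qed.

Lemma partial_sums_subsum (R : realType) (b : R^nat) (k : nat) (f : R) :
  f \in partial_sums b k -> subsum_set b f.
Proof.
move=> fF; apply/(subsum_split b k); exists f; rewrite // subrr.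
exact: subsum0.
Qed.

(* A sum using a term of index at most [k] is at least [b k]. *)
Lemma tail_subsum_small (R : realType) (b : R^nat) (B : R) (j k : nat) (y : R) :
  (forall i, 0 <= b i) -> series b @ \oo --> B -> (forall i, b i.+1 <= b i) ->
  (j <= k.+1)%N -> y < b k -> subsum_set (tail_terms b j) y ->
  subsum_set (tail_terms b k.+1) y.
Proof.
move=> b0 bB bdec jk yk yj.
have anti i : (i <= k)%N -> b k <= b i.
  move=> ik; rewrite -(subnKC ik); elim: (k - i)%N => [|d IHd].
    by rewrite addn0.
  by rewrite addnS (le_trans (bdec _)).
move: (k.+1 - j)%N (subnKC jk) yj => d {jk}; elim: d j => [|d IHd] j jd yj.
  by rewrite -jd addn0.
case/tail_subsum_step: yj => [yj|/subsum_bounds yj].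
  by apply: IHd yj; rewrite addSnnS.
have /andP[] := yj _ (tail_terms_ge0 _ b0) (cvg_tail_terms bB).
have := anti j ltac:(lia); lra.
Qed.

Lemma closed_gap (R : realType) (A : set R) (z : R) : closed A -> ~ A z ->
  exists2 e, 0 < e & forall w, z - e < w < z + e -> ~ A w.
Proof.
move=> Acl Az; have /nbhs_ballP [e /= e0 eA] : nbhs z (~` A).
  by apply: open_nbhs_nbhs; split=> //; exact: closed_openC.
exists e => // w wz; apply: eA; rewrite /ball /= ltr_distlC; lra.
Qed.

(** * Segments in tail subsum sets *)

(** A Baire argument for two closed sets: either [T] contains the open segment, or it misses a point
    of it, hence a neighbourhood, where the translate of [T] by [b k] has to fill the segment. *)
Lemma tail_segment (R : realType) (b : R^nat) (B p q : R) (k : nat) :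
  (forall i, 0 <= b i) -> series b @ \oo --> B -> p < q ->
  (forall z, p <= z <= q -> subsum_set (tail_terms b k) z) ->
  exists p' q', p' < q' /\
    forall z, p' <= z <= q' -> subsum_set (tail_terms b k.+1) z.
Proof.
move=> b0 bB pq pqT; set T := subsum_set (tail_terms b k.+1).
have Tcl : closed T := subsum_closed (tail_terms_ge0 _ b0) (cvg_tail_terms bB).
have [[z [zpq nTz]]|H] := pselect (exists z, p < z < q /\ ~ T z); last first.
  exists ((2 * p + q) / 3), ((p + 2 * q) / 3); split; first lra.
  move=> z zpq; apply: contrapT => nTz; apply: H; exists z; split => //; lra.
have [e e0 eT] := closed_gap Tcl nTz.
have [d [d0 de dq]] : exists d, [/\ 0 < d, d < e & z + d <= q].
  exists (Num.min (e / 2) (q - z)); split.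
  - by rewrite lt_min; apply/andP; split; lra.
  - by rewrite gt_min; apply/orP; left; lra.
  - by rewrite addrC -lerBrDr ge_min lexx orbT.
exists (z - b k), (z + d - b k); split; first lra.
move=> w wz; have /tail_subsum_step [Tw|] : subsum_set (tail_terms b k) (w + b k).
- by apply: pqT; lra.
- by case: (eT (w + b k)) => //; lra.
- by rewrite addrK.
Qed.

(** Some tail has length below [e] and still contains a segment; moving it by the finite sum [f]
    that underlies [y] puts it in the same short copy as [y]. *)
Lemma subsum_segment_near (R : realType) (b : R^nat) (B p q : R) :
  (forall i, 0 <= b i) -> series b @ \oo --> B -> p < q ->
  (forall z, p <= z <= q -> subsum_set b z) ->
  forall y e, subsum_set b y -> 0 < e ->
  exists p' q', [/\ y - e < p', p' < q', q' < y + e &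
    forall z, p' <= z <= q' -> subsum_set b z].
Proof.
move=> b0 bB pq pqT y e yb e0.
have [k _ /(_ k (leqnn k)) /= ke] := remainder_lt e0 bB.
have [p' [q' [pq' pqT']]] : exists p' q', p' < q' /\
    forall z, p' <= z <= q' -> subsum_set (tail_terms b k) z.
  clear ke; elim: k => [|k [p' [q' [pq' pqT']]]]; first by exists p, q.
  exact: tail_segment b0 bB pq' pqT'.
have bd z : subsum_set (tail_terms b k) z -> 0 <= z <= remainder b B k.
  exact: subsum_bounds (tail_terms_ge0 k b0) (cvg_tail_terms bB).
have [f fF /bd fy] := (subsum_split b k y).1 yb.
have := bd _ (pqT' p' ltac:(lra)); have := bd _ (pqT' q' ltac:(lra)) => ? ?.
exists (f + p'), (f + q'); split; try lra.
move=> z zpq; apply/(subsum_split b k); exists f => //; apply: pqT'; lra.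
Qed.

(** * Gaps near 0 and endpoints of gaps *)

Definition exceeds_often (R : realType) (b : R^nat) (B : R) : Prop :=
  forall n, exists2 k, (n <= k)%N & remainder b B k.+1 < b k.

(** Below [b k] only later terms can be used, and they add up to at most [remainder b B k.+1]; if
    [b k] exceeds this, the midpoint of the two is missed. It is small when [k] is large. *)
Lemma tail_gap (R : realType) (b : R^nat) (B w : R) (m : nat) :
  (forall i, 0 <= b i) -> series b @ \oo --> B -> (forall i, b i.+1 <= b i) ->
  exceeds_often b B -> 0 < w ->
  exists p, [/\ 0 < p, p < w & ~ subsum_set (tail_terms b m) p].
Proof.
move=> b0 bB bdec bex w0.
have [n _ nw] := remainder_lt w0 bB.
have [k] := bex (maxn n m); rewrite geq_max => /andP[nk mk] exk.
have := remainder_ge0 k.+1 b0 bB; have := nw k nk => /= kw r0.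
move: kw; rewrite (remainderS b B k) => kw.
exists ((remainder b B k.+1 + b k) / 2); split; try lra.
move=> pT; have := tail_subsum_small b0 bB bdec (leqW mk) _ pT => /(_ ltac:(lra)).
move=> /(subsum_bounds (tail_terms_ge0 _ b0) (cvg_tail_terms bB)); lra.
Qed.

Lemma seq_gap_above (R : realType) (s : seq R) (v : R) :
  exists2 d, 0 < d & forall g, g \in s -> v < g -> v + d <= g.
Proof.
elim: s => [|h s [d d0 ds]]; first by exists 1.
case: (ltP v h) => vh; last first.
  exists d => // g; rewrite inE => /orP [/eqP -> //|/ds //].
  by rewrite ltNge vh.
exists (Num.min d (h - v)); first by rewrite lt_min d0 subr_gt0.
move=> g; rewrite inE => /orP [/eqP -> _|gs vg].
  by rewrite addrC -lerBrDr ge_min lexx orbT.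
by rewrite (le_trans _ (ds g gs vg)) // lerD2l ge_min lexx.
Qed.

(* A right endpoint of a gap is a finite sum [v], and the part of the subsum set
   just above [v] is a copy of a tail subsum set, which has gaps near 0. *)
Lemma subsum_gap_right (R : realType) (b : R^nat) (B z v : R) :
  (forall i, 0 <= b i) -> series b @ \oo --> B -> (forall i, b i.+1 <= b i) ->
  exceeds_often b B -> z < v -> subsum_set b v ->
  (forall u, z <= u < v -> ~ subsum_set b u) ->
  forall w, v < w -> exists2 p, v < p < w & ~ subsum_set b p.
Proof.
move=> b0 bB bdec bex zv vb gap w vw.
have zv0 : 0 < v - z by lra.
have [k _ /(_ k (leqnn k)) /= kzv] := remainder_lt zv0 bB.
have bd y : subsum_set (tail_terms b k) y -> 0 <= y <= remainder b B k.
  exact: subsum_bounds (tail_terms_ge0 k b0) (cvg_tail_terms bB).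
have ge_v g : g \in partial_sums b k -> z < g -> v <= g.
  move=> gF zg; rewrite leNgt; apply/negP => gv.
  by apply: (gap g); [lra|exact: partial_sums_subsum gF].
have [d d0 dF] := seq_gap_above (partial_sums b k) v.
have d'0 : 0 < Num.min d (w - v) by rewrite lt_min d0 subr_gt0.
have [p [p0]] := tail_gap k b0 bB bdec bex d'0.
rewrite lt_min => /andP[pd pw] pT; exists (v + p); first lra.
(* The copy of the tail that holds [v + p] is shorter than the gap, so it starts above [z], hence at
   or above [v]; by the choice of [d] it can only start at [v]. *)
move=> /(subsum_split b k) [g gF gp]; have gp' := bd _ gp.
have vg : v <= g by apply: ge_v => //; lra.
move: vg; rewrite le_eqVlt => /orP [/eqP vg|vg]; last by have := dF g gF vg; lra.
by apply: pT; move: gp; rewrite -vg addrAC subrr add0r.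
Qed.

(** Reflecting [y] to [B - y] exchanges left and right endpoints of gaps. *)
Lemma subsum_gap_left (R : realType) (b : R^nat) (B z v : R) :
  (forall i, 0 <= b i) -> series b @ \oo --> B -> (forall i, b i.+1 <= b i) ->
  exceeds_often b B -> v < z -> subsum_set b v ->
  (forall u, v < u <= z -> ~ subsum_set b u) ->
  forall w, w < v -> exists2 p, w < p < v & ~ subsum_set b p.
Proof.
move=> b0 bB bdec bex vz vb gap w wv.
have refl := @subsum_refl _ _ _ _ bB.
have [| | |p pv pb] :=
    @subsum_gap_right _ b B (B - z) (B - v) b0 bB bdec bex _ (refl _ vb) _ (B - w).
- lra.
- move=> u uv ub; apply: (gap (B - u)); [lra|exact: refl].
- lra.
- exists (B - p); first lra.
  by move=> /refl; rewrite (_ : B - (B - p) = p) //; ring.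
Qed.

(** * Sequences whose terms all exceed their tails *)

(** The two translates of the next tail lie on both sides of the gap between [r] and [b k], so a
    segment lies in one of them and keeps its length [l]. *)
Lemma tail_segment_exceeding (R : realType) (b : R^nat) (B p l : R) (k : nat) :
  (forall i, 0 <= b i) -> series b @ \oo --> B -> remainder b B k.+1 < b k ->
  0 <= l -> (forall t, 0 <= t <= l -> subsum_set (tail_terms b k) (p + t)) ->
  exists p', forall t, 0 <= t <= l -> subsum_set (tail_terms b k.+1) (p' + t).
Proof.
move=> b0 bB rb l0 pT; set r := remainder b B k.+1 in rb.
have bd y : subsum_set (tail_terms b k.+1) y -> 0 <= y <= r.
  exact: subsum_bounds (tail_terms_ge0 _ b0) (cvg_tail_terms bB).
have step t : 0 <= t <= l -> subsum_set (tail_terms b k.+1) (p + t) /\ p + t <= r \/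
    subsum_set (tail_terms b k.+1) (p + t - b k) /\ b k <= p + t.
  move=> /pT /tail_subsum_step [H|H]; [left|right]; split=> //; have := bd _ H; lra.
case: (leP p r) => pr; last first.
  exists (p - b k) => t tl; case: (step t tl) => -[H]; first lra.
  by move: H; rewrite addrAC.
case: (leP (p + l) r) => plr.
  by exists p => t tl; case: (step t tl) => -[//]; lra.
(* The segment would now cross [r]: either the midpoint of the gap or the upper end of the segment
   falls into the gap. *)
case: (leP (b k) (p + l)) => blp.
  by case: (step ((r + b k) / 2 - p) ltac:(lra)) => -[_]; lra.
by case: (step l ltac:(lra)) => -[_]; lra.
Qed.

(** A segment would pass to every tail with its full length, while the lengths of the tails tend to
    0. *)
Lemma subsum_no_segment (R : realType) (b : R^nat) (B p q : R) :
  (forall i, 0 <= b i) -> series b @ \oo --> B ->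
  (forall k, remainder b B k.+1 < b k) -> p < q ->
  exists2 z, p <= z <= q & ~ subsum_set b z.
Proof.
move=> b0 bB ex pq; apply: contrapT => H.
have qp0 : 0 < q - p by lra.
have [k _ /(_ k (leqnn k)) /= kl] := remainder_lt qp0 bB.
have [p' p'T] : exists p', forall t, 0 <= t <= q - p ->
    subsum_set (tail_terms b k) (p' + t).
  clear kl; elim: k => [|k [p' p'T]].
    exists p => t tl; apply: contrapT => nt; apply: H; exists (p + t) => //; lra.
  by apply: tail_segment_exceeding b0 bB (ex k) _ p'T; lra.
have bd y : subsum_set (tail_terms b k) y -> 0 <= y <= remainder b B k.
  exact: subsum_bounds (tail_terms_ge0 _ b0) (cvg_tail_terms bB).
have := bd _ (p'T 0 ltac:(lra)); have := bd _ (p'T (q - p) ltac:(lra)); lra.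
Qed.

(** * Trivial components and Cantorvals *)

(** A connected set is an interval; reaching beyond [v], it would contain a missing point. *)
Lemma trivial_point_gaps (R : realType) (A : set R) (v : R) : A v ->
  (forall w, v < w -> exists2 p, v < p < w & ~ A p) ->
  (forall w, w < v -> exists2 p, w < p < v & ~ A p) ->
  trivial_points A v.
Proof.
move=> Av gr gl; split=> //; apply/seteqP; split; last first.
  by move=> _ ->; exact: connected_component_refl.
move=> w [C [Cv CA /connected_intervalP Ci] Cw] /=.
case: (ltgtP w v) => // [/gl|/gr] [p pvw pA]; exfalso; apply: pA; apply: CA.
- by apply: (Ci w v) => //; case/andP: pvw => /ltW -> /ltW ->.
- by apply: (Ci v w) => //; case/andP: pvw => /ltW -> /ltW ->.
Qed.

Lemma no_segment_totally_disconnected (R : realType) (A : set R) :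
  (forall p q, p < q -> exists2 z, p <= z <= q & ~ A z) ->
  totally_disconnected A.
Proof.
move=> H v Av; apply: (trivial_point_gaps Av _ _).2 => w vw.
- have [|z zvw zA] := H ((2 * v + w) / 3) ((v + 2 * w) / 3); first lra.
  by exists z => //; lra.
- have [|z zvw zA] := H ((2 * w + v) / 3) ((w + 2 * v) / 3); first lra.
  by exists z => //; lra.
Qed.

Lemma not_totally_disconnected_segment (R : realType) (A : set R) :
  ~ totally_disconnected A ->
  exists p q, p < q /\ forall z, p <= z <= q -> A z.
Proof.
move=> ntd; apply: contrapT => H; apply: ntd.
apply: no_segment_totally_disconnected => p q pq; apply: contrapT => nz.
apply: H; exists p, q; split => // z zpq; apply: contrapT => zA.
by apply: nz; exists z.
Qed.

(* Points of the gaps of [A] accumulate at the lower end [c] of the component [C];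
   the right endpoints of these gaps are trivial components. *)
Lemma gaps_below_component (R : realType) (A C : set R) (c e : R) :
  closed A -> is_interval C -> C `<=` A ->
  (forall D, is_interval D -> D `<=` A -> D `&` C !=set0 -> D `<=` C) ->
  (exists p q, [/\ C p, C q & p < q]) ->
  (forall p, C p -> c <= p) -> (forall e, 0 < e -> exists2 p, C p & p < c + e) ->
  (forall z v, z < v -> A v -> (forall u, z <= u < v -> ~ A u) ->
    forall w, v < w -> exists2 p, v < p < w & ~ A p) ->
  0 < e -> exists v, [/\ c - e < v < c, A v,
    forall w, v < w -> exists2 p, v < p < w & ~ A p &
    forall w, w < v -> exists2 p, w < p < v & ~ A p].
Proof.
move=> Acl Ci CA Cmax [p0 [q0 [Cp0 Cq0 pq0]]] cC Cc gr e0.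
have inC u : c < u <= q0 -> C u.
  move=> /andP[cu uq].
  have uc0 : 0 < u - c by lra.
  have [p Cp pu] := Cc _ uc0.
  by apply: (Ci p q0) => //; apply/andP; split; lra.
have cp0 := cC _ Cp0.
have Ac : A c.
  apply: contrapT => /(closed_gap Acl) [d d0 dA].
  have [p Cp pd] := Cc _ d0; apply: (dA p); last exact: CA.
  by have := cC _ Cp; lra.
(* Otherwise the segment from [c - e / 2] to [q0] lies in [A] and meets [C], so by maximality [C]
   extends below [c]. *)
have [z [zc zA]] : exists z, c - e < z < c /\ ~ A z.
  apply: contrapT => H.
  suff /(_ (c - e / 2)) : [set` `[c - e / 2, q0]] `<=` C.
    by rewrite /= in_itv /= => /(_ ltac:(lra)) /cC; lra.
  apply: Cmax; first exact: interval_is_interval.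
    move=> u; rewrite /= in_itv /= => uc; apply: contrapT => Au.
    case: (ltgtP u c) => uc'; last by apply: Au; rewrite uc'.
      by apply: H; exists u; split => //; lra.
    by apply: Au; apply: CA; apply: inC; lra.
  by exists q0; split=> //; rewrite /= in_itv /=; lra.
(* The first point [v] of [A] after the missing point [z] is the right endpoint of the gap around
   [z]. *)
pose S := [set u | z <= u /\ A u].
have Sinf : has_inf S.
  split; first by exists c; split => //; lra.
  by exists z => u [].
pose v := inf S.
have zv : z <= v by apply: lb_le_inf; [exact: Sinf.1|move=> u []].
have vS u : z <= u -> A u -> v <= u.
  by move=> zu Au; apply: ge_inf; [exact: Sinf.2|split].
have Av : A v.
  apply: contrapT => /(closed_gap Acl) [d d0 dA].
  have [u [zu Au] uv] := inf_adherent d0 Sinf.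
  by apply: (dA u) => //; have := vS u zu Au; rewrite -/v in uv; lra.
have zltv : z < v.
  by rewrite lt_neqAle zv andbT; apply/eqP => zv'; apply: zA; rewrite zv'.
have gap u : z <= u < v -> ~ A u.
  by move=> /andP[zu uv] /(vS u zu); lra.
have grv := gr z v zltv Av gap.
have vc : v <= c by apply: vS => //; lra.
exists v; split => //; last first.
  move=> w wv; exists ((Num.max w z + v) / 2); last apply: gap.
    have : Num.max w z < v by rewrite gt_max wv.
    have : w <= Num.max w z by rewrite le_max lexx.
    by lra.
  have : Num.max w z < v by rewrite gt_max wv.
  have : z <= Num.max w z by rewrite le_max lexx orbT.
  by lra.
(* Missing points accumulate at [v] from above, whereas the points just above [c] belong to [C]. *)
have vltc : v < c.
  rewrite lt_neqAle vc andbT; apply/eqP => vc'.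
  have [|p pc pA] := grv q0; first lra.
  by apply: pA; apply: CA; apply: inC; lra.
lra.
Qed.

Lemma limit_point_near (R : realType) (P : set R) (c : R) :
  (forall e, 0 < e -> exists2 v, P v & v != c /\ `|c - v| < e) ->
  limit_point P c.
Proof.
move=> H U /nbhs_ballP [e /= e0 eU]; have [v Pv [vc ve]] := H e e0.
by exists v; split=> //; apply: eU.
Qed.

Lemma bounded_closed_subset_compact (R : realType) (A : set R) (lo hi : R) :
  closed A -> (forall y, A y -> lo <= y <= hi) -> compact A.
Proof.
move=> Acl AB; apply: subclosed_compact Acl (@segment_compact _ lo hi) _.
by move=> y /AB; rewrite /= in_itv.
Qed.

(** Segments near every point make the interior dense. The lower end of a component is treated
    directly, the upper end by reflection in 0. *)
Lemma Cantorval_of_gaps (R : realType) (A : set R) (lo hi : R) :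
  A !=set0 -> closed A -> (forall y, A y -> lo <= y <= hi) ->
  (forall y e, A y -> 0 < e -> exists p q, [/\ y - e < p, p < q, q < y + e &
    forall z, p <= z <= q -> A z]) ->
  (forall z v, z < v -> A v -> (forall u, z <= u < v -> ~ A u) ->
    forall w, v < w -> exists2 p, v < p < w & ~ A p) ->
  (forall z v, v < z -> A v -> (forall u, v < u <= z -> ~ A u) ->
    forall w, w < v -> exists2 p, w < p < v & ~ A p) ->
  symmetric_Cantorval A.
Proof.
move=> A0 Acl AB segs gr gl.
split=> //; first exact: bounded_closed_subset_compact Acl AB.
  apply/seteqP; split.
    move=> y Ay U /nbhs_ballP [e /= e0 eU].
    have [p [q [yp pq qy pqA]]] := segs y e Ay e0.
    exists ((p + q) / 2); split; last by apply: eU; rewrite /ball /= ltr_distlC; lra.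
    apply/nbhs_ballP; exists ((q - p) / 2) => /=; first lra.
    by move=> w; rewrite /ball /= ltr_distlC => ?; apply: pqA; lra.
  by move=> y /(closure_subset (@interior_subset _ A)); rewrite -(closure_id A).1.
move=> y Ay nC; set C := connected_component A y in nC *.
have Cy : C y by exact: connected_component_refl.
have CA : C `<=` A by exact: connected_component_sub.
have Ci : is_interval C by apply/connected_intervalP; exact: component_connected.
have Cmax D : is_interval D -> D `<=` A -> D `&` C !=set0 -> D `<=` C.
  move=> Di DA [u [Du Cu]].
  rewrite /C (same_connected_component Cu).
  apply: connected_component_max => //; exact/connected_intervalP.
have C2 : exists p q, [/\ C p, C q & p < q].
  apply: contrapT => H; apply: nC; apply/seteqP; split; last by move=> _ ->.
  move=> u Cu /=; case: (ltgtP u y) => // ?; exfalso; apply: H.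
    by exists u, y.
  by exists y, u.
have Cinf : has_inf C by split; [exists y|exists lo => u /CA /AB /andP[]].
have Csup : has_sup C by split; [exists y|exists hi => u /CA /AB /andP[]].
split; apply: limit_point_near => e e0.
  have [||v [vc Av vr vl]] := gaps_below_component (c := inf C) Acl Ci CA Cmax C2 _ _ gr e0.
  - by move=> p Cp; apply: ge_inf => //; exact: Cinf.2.
  - by move=> d d0; have [p Cp pd] := inf_adherent d0 Cinf; exists p.
  exists v; first exact: trivial_point_gaps.
  by split; [apply/eqP; lra|rewrite ltr_distlC; lra].
(* The upper end of [C] is mirrored to a lower end, and left endpoints of gaps to right
   endpoints. *)
pose A' := [set z | A (- z)]; pose C' := [set z | C (- z)].
have A'cl : closed A'.
  by apply: closed_comp Acl => z _; exact: opp_continuous.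
have C'i : is_interval C'.
  by move=> p q Cp Cq u upq; apply: (Ci (- q) (- p)) => //; rewrite !lerN2 andbC.
have C'A : C' `<=` A' by move=> p /CA.
have C'max D : is_interval D -> D `<=` A' -> D `&` C' !=set0 -> D `<=` C'.
  move=> Di DA [u [Du Cu]] w Dw; apply: (Cmax [set z | D (- z)]).
  - by move=> p q Dp Dq v vpq; apply: (Di (- q) (- p)) => //; rewrite !lerN2 andbC.
  - by move=> z /DA; rewrite /A' /= opprK.
  - by exists (- u); rewrite /= opprK.
  - by rewrite /= opprK.
have C'2 : exists p q, [/\ C' p, C' q & p < q].
  have [p [q [Cp Cq pq]]] := C2; exists (- q), (- p).
  by rewrite /C' /= !opprK ltrN2.
have gr' z v : z < v -> A' v -> (forall u, z <= u < v -> ~ A' u) ->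
    forall w, v < w -> exists2 p, v < p < w & ~ A' p.
  move=> zv Av gap w vw.
  have [|//|||p pvw pA] := gl (- z) (- v) _ _ _ (- w).
  - by rewrite ltrN2.
  - move=> u uvz Au; apply: (gap (- u)); first lra.
    by rewrite /A' /= opprK.
  - by rewrite ltrN2.
  by exists (- p); [lra|rewrite /A' /= opprK].
have [||v [vc Av vr vl]] := gaps_below_component
    (c := - sup C) A'cl C'i C'A C'max C'2 _ _ gr' e0.
- by move=> p Cp; rewrite lerNl; apply: ub_le_sup => //; exact: Csup.2.
- move=> d d0; have [p Cp pd] := sup_adherent d0 Csup; exists (- p); last lra.
  by rewrite /C' /= opprK.
exists (- v); last by split; [apply/eqP; lra|rewrite ltr_distlC; lra].
apply: trivial_point_gaps => // w wv.
- by have [|p pw pA] := vl (- w); [lra|exists (- p) => //; lra].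
- by have [|p pw pA] := vr (- w); [lra|exists (- p) => //; lra].
Qed.

(** * Counting intervals *)

(** Such points witness a lower bound on the number of intervals: no interval inside [A] contains
    two of them. *)
Definition gap_separated (R : realType) (A : set R) (m : nat) : Prop :=
  exists f : nat -> R, (forall i, (i < m)%N -> A (f i)) /\
    forall i j, (i < j < m)%N -> exists2 z, f i < z < f j & ~ A z.

Lemma separated1 (R : realType) (A : set R) (y : R) : A y -> gap_separated A 1.
Proof. by move=> Ay; exists (fun=> y); split=> // i j; lia. Qed.

(* [subsum_set (tail_terms b i)] looks like [subsum_set (tail_terms b k.+1)]
   at each of its ends, up to the gap of length [b k - remainder b B k.+1]. *)
Lemma separated_double (R : realType) (b : R^nat) (B : R) (i k m : nat) :
  (forall i, 0 <= b i) -> series b @ \oo --> B -> (forall i, b i.+1 <= b i) ->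
  remainder b B k.+1 < b k -> (i <= k)%N ->
  gap_separated (subsum_set (tail_terms b k.+1)) m ->
  gap_separated (subsum_set (tail_terms b i)) (m + m).
Proof.
move=> b0 bB bdec exk ik [f [fT fgap]].
set r := remainder b B k.+1 in exk.
have small y : y < b k -> subsum_set (tail_terms b i) y ->
    subsum_set (tail_terms b k.+1) y.
  exact: tail_subsum_small b0 bB bdec (leqW ik).
have bd y : subsum_set (tail_terms b k.+1) y -> 0 <= y <= r.
  exact: subsum_bounds (tail_terms_ge0 _ b0) (cvg_tail_terms bB).
have refl j y : subsum_set (tail_terms b j) y ->
    subsum_set (tail_terms b j) (remainder b B j - y).
  exact: subsum_refl (cvg_tail_terms bB).
have widen j y : (i <= j)%N -> subsum_set (tail_terms b j) y ->
    subsum_set (tail_terms b i) y.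
  move=> /subnKC <-; elim: (j - i)%N y => [|d IHd] y; first by rewrite addn0.
  by rewrite addnS => Ty; apply: IHd; apply/tail_subsum_step; left.
have ri : remainder b B k <= remainder b B i.
  rewrite -(subnKC ik); elim: (k - i)%N => [|d IHd]; first by rewrite addn0.
  rewrite addnS; have := remainderS b B (i + d); have := b0 (i + d)%N; lra.
(* Shifting by [c] carries the lower copy, between 0 and [r], to the upper end of the tail at
   [i]. *)
pose c := remainder b B i - r.
have cb : b k <= c by move: ri; rewrite (remainderS b B k) /c /r; lra.
exists (fun j => if (j < m)%N then f j else c + f (j - m)%N); split.
  move=> j jm; case: ifP => jm'; first by apply: (widen k.+1); [lia|exact: fT].
  have -> : c + f (j - m)%N = remainder b B i - (r - f (j - m)%N) by rewrite /c; ring.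
  by apply: (refl i); apply: (widen k.+1); [lia|apply: refl; apply: fT; lia].
move=> j l /andP[jl lm].
case: (ltnP j m) => jm; case: (ltnP l m) => lm'.
- have [z zf zT] := fgap j l ltac:(lia); exists z => // zT'.
  by have := bd _ (fT l lm') => ?; apply: zT; apply: small zT'; lra.
- have := bd _ (fT j jm); have := bd _ (fT (l - m)%N ltac:(lia)) => ? ?.
  exists ((r + b k) / 2); first lra.
  by move=> zT; have /bd : subsum_set (tail_terms b k.+1) ((r + b k) / 2);
    [apply: small zT|]; lra.
- by lia.
have [z zf zT] := fgap (j - m)%N (l - m)%N ltac:(lia).
exists (c + z); first lra.
have := bd _ (fT (j - m)%N ltac:(lia)); have := bd _ (fT (l - m)%N ltac:(lia)) => ? ?.
(* Reflection in the tail at [i] sends [c + z] into the lower copy; reflection in the tail at [k.+1]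
   then leads to [z]. *)
move=> /refl; rewrite (_ : _ - _ = r - z) => [rzT|]; last by rewrite /c; ring.
have /refl : subsum_set (tail_terms b k.+1) (r - z) by apply: small rzT; lra.
by rewrite -/r (_ : r - (r - z) = z) //; ring.
Qed.

Lemma separated_exceeding (R : realType) (b : R^nat) (B : R) (K : nat) :
  (forall i, 0 <= b i) -> series b @ \oo --> B -> (forall i, b i.+1 <= b i) ->
  gap_separated (subsum_set b)
    (2 ^ \sum_(0 <= k < K) (remainder b B k.+1 < b k)%R).
Proof.
move=> b0 bB bdec.
(* The indices [i] and [j] are decoupled: a term exceeding its tail moves both to [j.+1], any other
   term moves only [j]. *)
suff H d j i : (j + d = K)%N -> (i <= j)%N -> gap_separated (subsum_set (tail_terms b i))
    (2 ^ \sum_(j <= k < K) (remainder b B k.+1 < b k)%R).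
  exact: (H K 0 0)%N.
elim: d j i => [|d IHd] j i jK ij.
  rewrite -jK addn0 big_geq //; exact: separated1 (subsum0 _).
rewrite big_ltn; last by lia.
have IH i' := IHd j.+1 i' ltac:(lia).
case: ltP => [exj|_]; last by rewrite add0n; apply: IH; lia.
rewrite expnD expn1 mul2n -addnn.
by apply: separated_double b0 bB bdec exj ij _; apply: IH.
Qed.

(** By pigeonhole: if two of the points shared an interval, the missing point between them would lie
    in [A]. *)
Lemma separated_card_le (R : realType) (A : set R) (m n : nat) :
  gap_separated A m -> union_of_closed_itvs A n -> (m <= n)%N.
Proof.
move=> [f [fA fgap]] [lo [hi [_ _ AE]]].
have /all_sig [g gP] (i : 'I_m) : {j : 'I_n | closed_itv (lo j) (hi j) (f i)}.
  apply: cid; have := fA i (ltn_ord i); rewrite AE => -[j /= jn fj].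
  by exists (Ordinal jn).
rewrite -(card_ord m) -(card_ord n); apply: (leq_card g).
have aux (i j : 'I_m) : (i < j)%N -> g i = g j -> False.
  move=> ij gij; have [z zf] := fgap i j ltac:(by rewrite ij ltn_ord).
  apply; rewrite AE; exists (g i); first exact: (ltn_ord (g i)).
  have /andP[loi _] := gP i; have /andP[_ hij] := gP j.
  case/andP: zf => fz zf; apply/andP; split.
    by rewrite (le_trans loi) // lee_fin ltW.
  by rewrite gij (le_trans _ hij) // lee_fin ltW.
move=> i j gij; apply/val_inj; case: (ltngtP (val i) (val j)) => // ij.
  by case: (aux i j ij).
by case: (aux j i ij).
Qed.

(* A representation by the least number of intervals is disjoint, as two
   intersecting ones could be merged. *)
Lemma disjoint_union_of_itvs (R : realType) (A : set R) (lo hi : nat -> R) (n : nat) :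
  (forall i, (i < n)%N -> lo i <= hi i) ->
  (forall y, A y <-> exists2 i, (i < n)%N & lo i <= y <= hi i) ->
  exists2 n', (n' <= n)%N & union_of_closed_itvs A n'.
Proof.
move: lo hi; elim/ltn_ind: n => n IHn lo hi lohi AE.
have [H|H] := pselect (exists i j y, [/\ (i < j < n)%N, lo i <= y <= hi i &
    lo j <= y <= hi j]); last first.
  exists n => //; exists (fun i => (lo i)%:E), (fun i => (hi i)%:E); split.
  - by move=> i /lohi lh; exists (lo i); rewrite /closed_itv /= !lee_fin lexx.
  - move=> i j /= ni nj [y []]; rewrite /closed_itv /= !lee_fin => yi yj.
    by case: (ltngtP i j) => // ij; exfalso; apply: H;
      [exists i, j, y|exists j, i, y]; split=> //; lia.
  - apply/seteqP; split => y.
      by move=> /AE [i ni yi]; exists i => //; rewrite /closed_itv /= !lee_fin.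
    by move=> [i /= ni]; rewrite /closed_itv /= !lee_fin => yi; apply/AE; exists i.
have [i [j [y [ijn yi yj]]]] := H.
pose lo' t := if t == i then Num.min (lo i) (lo j) else if t == j then lo n.-1 else lo t.
pose hi' t := if t == i then Num.max (hi i) (hi j) else if t == j then hi n.-1 else hi t.
have [|||n' n'n An'] := IHn n.-1 _ lo' hi'.
- by lia.
- move=> t tn; rewrite /lo' /hi'; case: eqP => [_|_].
    by rewrite ge_min le_max; apply/orP; left; apply/orP; left; apply: lohi; lia.
  by case: eqP => _; apply: lohi; lia.
- move=> z; rewrite AE; split => [[t tn zt]|[t tn]].
    have [tij|tij] := boolP ((t == i) || (t == j)).
      exists i; first lia; rewrite /lo' /hi' eqxx ge_min le_max.
      by case/orP: tij => /eqP tE; move: zt; rewrite tE => /andP[-> ->]; rewrite ?orbT.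
    have [ti tj] : t <> i /\ t <> j by split=> tE; move: tij; rewrite tE eqxx ?orbT.
    have [tn1|tn1] := eqVneq t n.-1.
      exists j; first lia.
      have /negbTE ji : j != i by apply/eqP; lia.
      by rewrite /lo' /hi' ji eqxx -tn1.
    exists t; first lia.
    by rewrite /lo' /hi' !ifN //; apply/eqP.
  rewrite /lo' /hi'; case: eqP => [_|ti].
    (* Both intervals contain [y], so on each side of [y] the one reaching further covers [z]. *)
    rewrite ge_min le_max => /andP[/orP lz /orP zh].
    case: (leP z y) => zy.
      case: lz => lz; [exists i|exists j]; try lia; apply/andP; split => //; lra.
    case: zh => zh; [exists i|exists j]; try lia; apply/andP; split => //; lra.
  by case: eqP => [_|tj] ?; [exists n.-1|exists t] => //; lia.
by exists n' => //; lia.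
Qed.

(** * Nonnegative series in the extended reals *)

Lemma nneseries_cvgE (R : realType) (p : R^nat) (s : R) : (forall k, 0 <= p k) ->
  (\sum_(0 <= k <oo) (p k)%:E = s%:E)%E <-> series p @ \oo --> s.
Proof.
move=> p0.
have H (t : R) : series p @ \oo --> t -> (\sum_(0 <= k <oo) (p k)%:E = t%:E)%E.
  move=> pt; apply/cvg_lim => //.
  have -> : (fun n => \sum_(0 <= k < n) (p k)%:E)%E = EFin \o series p.
    by apply/funext => n; rewrite sumEFin.
  by apply: cvg_EFin; first exact: nearW.
split; last exact: H.
move=> ps; have /cvg_ex [t pt] : cvgn (series p).
  by apply: nnseries_is_cvg => //; rewrite ps ltry.
by move: (H t pt); rewrite ps => -[->].
Qed.

Lemma nneseries_cvg_or_pinfty (R : realType) (p : R^nat) : (forall k, 0 <= p k) ->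
  (exists s : R, series p @ \oo --> s) \/
  ~ cvgn (series p) /\ (\sum_(0 <= k <oo) (p k)%:E = +oo)%E.
Proof.
move=> p0; have [|np] := pselect (cvgn (series p)); first by move/cvg_ex; left.
right; split=> //; apply/eqP; rewrite -leye_eq leNgt; apply/negP => pf.
by apply: np; exact: nnseries_is_cvg.
Qed.

Lemma nneseriesN_fin (R : realType) (p : R^nat) : (forall k, 0 <= p k) ->
  (\sum_(0 <= k <oo) (- p k)%:E = - \sum_(0 <= k <oo) (p k)%:E)%E.
Proof.
move=> p0; rewrite -limeN.
  by apply/congr_lim/funext => n; rewrite /= -sumeN //; apply: eq_bigr.
by apply: is_cvg_nneseries => n _ _; rewrite lee_fin.
Qed.

(** * Positive and negative parts; the divergent case *)

Definition pos_part (R : realType) (x : R^nat) : R^nat :=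
  fun k => if 0 < x k then x k else 0.

Definition neg_part (R : realType) (x : R^nat) : R^nat :=
  fun k => if x k < 0 then - x k else 0.

Lemma pos_part_ge0 (R : realType) (x : R^nat) k : 0 <= pos_part x k.
Proof. by rewrite /pos_part; case: ifP => // /ltW. Qed.

Lemma neg_part_ge0 (R : realType) (x : R^nat) k : 0 <= neg_part x k.
Proof. by rewrite /neg_part; case: ifP => // /ltW; rewrite oppr_ge0. Qed.

Lemma pos_sumE (R : realType) (x : R^nat) :
  pos_sum x = (\sum_(0 <= k <oo) (pos_part x k)%:E)%E.
Proof.
rewrite /pos_sum eseries_mkcond; apply: eq_eseriesr => k _.
by rewrite /pos_part; case: ifP.
Qed.

Lemma neg_sumE (R : realType) (x : R^nat) :
  neg_sum x = (- \sum_(0 <= k <oo) (neg_part x k)%:E)%E.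
Proof.
rewrite /neg_sum -nneseriesN_fin; last exact: neg_part_ge0.
rewrite eseries_mkcond; apply: eq_eseriesr => k _.
by rewrite /neg_part; case: ifP => _; rewrite ?opprK ?oppr0.
Qed.

Lemma parts_cvg0 (R : realType) (x : R^nat) : x @ \oo --> (0 : R) ->
  pos_part x @ \oo --> (0 : R) /\ neg_part x @ \oo --> (0 : R).
Proof.
move=> x0; have ax0 : (fun k => `|x k|) @ \oo --> (0 : R).
  by rewrite -[X in _ --> X](@normr0 R R); apply: cvg_norm.
split; apply: (squeeze_cvgr _ (cvg_cst 0) ax0); near=> k.
  by rewrite pos_part_ge0 /pos_part /=; case: ifP => // _; exact: ler_norm.
by rewrite neg_part_ge0 /neg_part /=; case: ifP => // _; rewrite -normrN ler_norm.
Unshelve. all: end_near. Qed.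

Fixpoint greedy (R : realType) (p : R^nat) (s : R) (n : nat) : R :=
  if n is k.+1 then
    if greedy p s k + p k <= s then greedy p s k + p k else greedy p s k
  else 0.

(** The running sum never exceeds [s]. If its limit [l] were below [s], every term smaller than
    [s - l] would be taken, hence all but finitely many, and the series would converge. *)
Lemma greedy_subsum (R : realType) (p : R^nat) (s : R) : (forall k, 0 <= p k) ->
  p @ \oo --> (0 : R) -> ~ cvgn (series p) -> 0 <= s -> subsum_set p s.
Proof.
move=> p0 pc np s0; pose g := greedy p s.
pose xi k := g k + p k <= s.
have gS n : g n.+1 = if xi n then g n + p n else g n by [].
have gE : series (fun k => (xi k)%:R * p k) = g.
  apply/funext => n; rewrite /series /=; elim: n => [|n IHn]; first by rewrite big_geq.
  by rewrite big_nat_recr //= IHn gS; case: (xi n) => /=; ring.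
have gs n : g n <= s by elim: n => [|n IHn] //; rewrite gS; case: ifP.
have gmono : {homo g : n m / (n <= m)%N >-> n <= m}.
  apply/nondecreasing_seqP => n; rewrite gS; case: ifP => // _.
  by have := p0 n; lra.
have /cvg_ex [l gl] : cvgn g.
  by apply: nondecreasing_is_cvgn => //; exists s => _ [n _ <-].
have gle n : g n <= l.
  have -> : l = limn g by apply/esym/cvg_lim.
  by apply: nondecreasing_cvgn_le => //; apply/cvg_ex; exists l.
have ls : l <= s.
  apply: (@closed_cvg _ _ _ _ g (fun y => y <= s)) gl; first exact: closed_le.
  exact: nearW.
exists xi; rewrite gE; suff <- : l = s by [].
apply/eqP; rewrite eq_le ls leNgt; apply/negP => lts.
have sl0 : 0 < s - l by lra.
have [n _ np'] : \forall n \near \oo, p n < s - l.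
  move/cvgrPdist_lt : pc => /(_ _ sl0); apply: filterS => k.
  by rewrite sub0r normrN; apply: le_lt_trans; exact: ler_norm.
apply: np; apply: (@nondecreasing_is_cvgn _ (series p)).
  by apply/nondecreasing_seqP => m; rewrite /series /= big_nat_recr //= lerDl.
exists (series p n + l) => _ [m _ <-].
have pm d : series p (n + d)%N - series p n = g (n + d)%N - g n.
  elim: d => [|d IHd]; first by rewrite addn0 !subrr.
  have -> : series p (n + d.+1)%N = series p (n + d)%N + p (n + d)%N.
    by rewrite addnS /series /= big_nat_recr.
  rewrite addnS gS ifT; first by rewrite addrAC IHd; ring.
  rewrite /xi.
  have := np' (n + d)%N (leq_addr _ _); have := gle (n + d)%N => /=; lra.
have smono : {homo series p : n m / (n <= m)%N >-> n <= m}.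
  by apply/nondecreasing_seqP => k; rewrite /series /= big_nat_recr //= lerDl.
apply: (le_trans (smono m (n + m)%N (leq_addl _ _))).
have := pm m; have := gle (n + m)%N; have : 0 <= g n by apply: (gmono 0%N n).
lra.
Qed.

Lemma subsum_of_parts (R : realType) (x : R^nat) (s t : R) :
  subsum_set (pos_part x) s -> subsum_set (neg_part x) t -> subsum_set x (s - t).
Proof.
move=> [xi xis] [zeta zt]; exists (fun k => if 0 < x k then xi k else zeta k).
apply: cvg_series_sub xis zt _ => k; rewrite /pos_part /neg_part.
by case: (ltgtP 0 (x k)) => [_|_|<-]; ring.
Qed.

Lemma subsum_le_pos (R : realType) (x : R^nat) (P s : R) :
  series (pos_part x) @ \oo --> P -> subsum_set x s -> s <= P.
Proof.
move=> xP [xi xis]; apply: cvg_series_le xis xP => k.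
rewrite /pos_part; case: ltP => xk; case: (xi k) => /=; lra.
Qed.

Lemma subsum_ge_neg (R : realType) (x : R^nat) (Q s : R) :
  series (neg_part x) @ \oo --> Q -> subsum_set x s -> - Q <= s.
Proof.
move=> xQ [xi xis].
have xQ' : series (- neg_part x) @ \oo --> - Q by rewrite seriesN; exact: cvgN.
apply: cvg_series_le xQ' xis => k; rewrite /neg_part fctE.
by case: ltP => xk; case: (xi k) => /=; lra.
Qed.

(** If just one part diverges, all terms of the convergent part are selected and a greedy choice
    corrects the difference; if both diverge, terms of one sign suffice. *)
Lemma subsum_divergent (R : realType) (x : R^nat) : x @ \oo --> (0 : R) ->
  ~ cvgn (series (pos_part x)) \/ ~ cvgn (series (neg_part x)) ->
  subsum_set x = closed_itv (neg_sum x) (pos_sum x).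
Proof.
move=> /parts_cvg0 [p0 q0] npq; rewrite pos_sumE neg_sumE.
have pge := pos_part_ge0 x; have qge := neg_part_ge0 x.
have gp s := @greedy_subsum R (pos_part x) s pge p0.
have gq s := @greedy_subsum R (neg_part x) s qge q0.
have [[P xP]|[np ->]] := nneseries_cvg_or_pinfty pge;
  have [[Q xQ]|[nq ->]] := nneseries_cvg_or_pinfty qge.
- by case: npq; [move/(_ (proj2 (cvg_ex _) (ex_intro _ P xP)))|
    move/(_ (proj2 (cvg_ex _) (ex_intro _ Q xQ)))].
- rewrite ((nneseries_cvgE P pge).2 xP); apply/seteqP; split => s.
    by move=> /(subsum_le_pos xP); rewrite /closed_itv /= leNye lee_fin.
  rewrite /closed_itv /= leNye lee_fin /= => sP; rewrite -(subKr P s).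
  by apply: subsum_of_parts; [exact: subsum_total xP|apply: gq => //; lra].
- rewrite ((nneseries_cvgE Q qge).2 xQ); apply/seteqP; split => s.
    by move=> /(subsum_ge_neg xQ); rewrite /closed_itv /= leey lee_fin andbT.
  rewrite /closed_itv /= leey lee_fin andbT => sQ; rewrite -(addrK Q s).
  by apply: subsum_of_parts; [apply: gp => //; lra|exact: subsum_total xQ].
- apply/seteqP; split => s _; first by rewrite /closed_itv /= leNye leey.
  case: (leP 0 s) => s0.
    by rewrite -(subr0 s); apply: subsum_of_parts; [exact: gp|exact: subsum0].
  rewrite -(opprK s) -[- - s]sub0r; apply: subsum_of_parts; first exact: subsum0.
  by apply: gq => //; lra.
Qed.

(** * Reduction to reordered absolute values *)

Lemma parts_sub (R : realType) (x : R^nat) k : x k = pos_part x k - neg_part x k.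
Proof. by rewrite /pos_part /neg_part; case: ltgtP => [_|_|<-]; ring. Qed.

Lemma parts_add (R : realType) (x : R^nat) k : `|x k| = pos_part x k + neg_part x k.
Proof.
rewrite /pos_part /neg_part; case: ltgtP => [xk|xk|<-].
- by rewrite gtr0_norm // addr0.
- by rewrite ltr0_norm // add0r.
- by rewrite normr0 addr0.
Qed.

Lemma subsum_abs (R : realType) (x : R^nat) (Q s : R) :
  series (neg_part x) @ \oo --> Q ->
  subsum_set x s <-> subsum_set (fun k => `|x k|) (s + Q).
Proof.
(* Adding [neg_part x] cancels a selected negative term and turns an unselected one into its
   absolute value. *)
have key k (e : bool) :
    (e (+) (x k < 0))%:R * `|x k| = e%:R * x k + neg_part x k.
  rewrite /neg_part; case: ltP => xk; [rewrite ltr0_norm //|rewrite ger0_norm //].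
    by case: e => /=; ring.
  by rewrite addbF addr0.
move=> xQ; split=> -[xi xis]; exists (fun k => xi k (+) (x k < 0)).
  by apply: cvg_series_add xis xQ _ => k; exact: key.
rewrite -(addrK Q s); apply: cvg_series_sub xis xQ _ => k.
by rewrite -{2}(addbK (x k < 0) (xi k)) key addrK.
Qed.

(** Nonnegative sums do not depend on the order, and the indices missed by [sigma] carry zero
    terms. *)
Lemma nneseries_reindex (R : realType) (b : R^nat) (sigma : nat -> nat) :
  (forall k, 0 <= b k) -> injective sigma ->
  [set k | b k != 0] `<=` range sigma ->
  (\sum_(0 <= k <oo) (b k)%:E = \sum_(0 <= k <oo) (b (sigma k))%:E)%E.
Proof.
move=> b0 sinj srange.
rewrite nneseries_esumT; last by move=> k; rewrite lee_fin.
rewrite nneseries_esumT; last by move=> k; rewrite lee_fin.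
rewrite -(esum_image setT sigma (fun k => (b k)%:E)); last by move=> i j _ _; exact: sinj.
rewrite [RHS]esum_mkcond; apply: eq_esum => k _; case: ifPn => // /negP ks.
apply/eqP; rewrite eqe; apply: contrapT => /negP bk; apply: ks.
by apply/mem_set/srange.
Qed.

Lemma subsum_reindex (R : realType) (b : R^nat) (sigma : nat -> nat) :
  (forall k, 0 <= b k) -> injective sigma ->
  [set k | b k != 0] `<=` range sigma ->
  subsum_set b = subsum_set (fun k => b (sigma k)).
Proof.
move=> b0 sinj srange.
have key (xi : nat -> bool) (s : R) : series (fun k => (xi k)%:R * b k) @ \oo --> s <->
    series (fun k => (xi (sigma k))%:R * b (sigma k)) @ \oo --> s.
  rewrite -nneseries_cvgE; last by move=> k; rewrite mulr_ge0.
  rewrite -nneseries_cvgE; last by move=> k; rewrite mulr_ge0.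
  rewrite (@nneseries_reindex _ (fun k => (xi k)%:R * b k) sigma) //.
    by move=> k; rewrite mulr_ge0.
  by move=> k /=; rewrite mulf_eq0 negb_or => /andP[_] /srange.
apply/seteqP; split=> s [xi xis].
  by exists (fun k => xi (sigma k)); apply/key.
(* Indices outside the range of [sigma] are deselected; by injectivity the choice at [sigma k] is
   [xi k]. *)
exists (fun k => `[< exists2 i, sigma i = k & xi i >]); apply/key.
rewrite (series_eqfun (v := fun k => (xi k)%:R * b (sigma k))) // => k.
congr (_%:R * _); congr nat_of_bool; apply/asboolP/idP; last by exists k.
by move=> [i /sinj ->].
Qed.

(** * Tails and intervals with extended endpoints *)

Lemma tail_cvgE (R : realType) (a : R^nat) (B : R) (k : nat) :
  (forall i, 0 <= a i) -> series a @ \oo --> B ->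
  tail a k = (remainder a B k.+1)%:E.
Proof.
move=> a0 aB; rewrite /tail eseries_cond eseries_mkcond.
rewrite -((nneseries_cvgE _ (tail_terms_ge0 k.+1 a0)).2 (cvg_tail_terms aB)).
by apply: eq_eseriesr => i _ /=; rewrite /tail_terms; case: (k < i)%N.
Qed.

Lemma tail_pinfty (R : realType) (a : R^nat) (k : nat) :
  (forall i, 0 <= a i) -> (\sum_(0 <= i <oo) (a i)%:E = +oo)%E -> tail a k = +oo%E.
Proof.
move=> a0; rewrite (@nneseries_split _ _ 0 k.+1); last by move=> i _; rewrite lee_fin.
rewrite add0n sumEFin /tail; by case: (\sum_(_ <= _ <oo) _)%E.
Qed.

(** The first alternative serves the divergent case, where an endpoint is infinite, the second the
    convergent case. *)
Lemma convex_hull_closed_itv (R : realType) (A : set R) (lo hi : \bar R) :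
  A `<=` closed_itv lo hi ->
  (A = closed_itv lo hi \/ exists l h, [/\ lo = l%:E, hi = h%:E, A l & A h]) ->
  convex_hull A = closed_itv lo hi.
Proof.
move=> AI; have convI : convex_set (closed_itv lo hi : set R^o).
  have aux (y z : R^o) (t : {i01 R}) : closed_itv lo hi y -> closed_itv lo hi z ->
      y <= z -> closed_itv lo hi (conv t y z).
    move=> /andP[ly yh] /andP[lz zh] yz.
    have := convR_itv t yz; rewrite in_itv /= => /andP[yc cz].
    by apply/andP; split; [apply: le_trans ly _|apply: le_trans zh]; rewrite lee_fin.
  move=> y z t /set_mem yI /set_mem zI; apply/mem_set.
  case: (leP y z) => [yz|/ltW zy].
    exact: aux.
  by rewrite convC; exact: aux.
move=> H; apply/seteqP; split=> [y|y yI D [Dc AD]].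
  by apply; split.
case: H => [AE|[l [h [lE hE Al Ah]]]]; first by apply: AD; rewrite AE.
move: yI; rewrite lE hE /closed_itv /= !lee_fin => /andP[ly yh].
case: (eqVneq l h) => [lh|lh].
  rewrite (_ : y = l); first exact: AD.
  by apply/eqP; rewrite eq_le ly lh yh.
have hl0 : 0 < h - l by rewrite subr_gt0 lt_neqAle lh (le_trans ly).
pose t := (y - l) / (h - l).
have t0 : 0 <= t by apply: divr_ge0; lra.
have t1 : t <= 1 by rewrite ler_pdivrMr //; lra.
suff <- : conv (Itv01 t0 t1) (h : R^o) (l : R^o) = y.
  by apply/set_mem/Dc; apply/mem_set; exact: AD.
by rewrite convR_line_path /line_path /= /t; field; exact: lt0r_neq0.
Qed.

Lemma card_bounded_pred (P : pred nat) (K N : nat) :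
  ([set k | (k < K)%N && P k] #= `I_N)%card -> (\sum_(0 <= k < K) P k = N)%N.
Proof.
have -> : [set k | (k < K)%N && P k] =
    [set` [fset k in [seq k <- index_iota 0 K | P k]]%fset].
  apply/seteqP; split => k /=; rewrite !inE /= mem_filter mem_index_iota /=;
    by rewrite andbC.
move=> /card_eq_fsetP <-; rewrite card_fseq undup_id ?filter_uniq ?iota_uniq //.
by rewrite size_filter -sum1_count [RHS]big_mkcond /=; apply: eq_bigr => k _; case: (P k).
Qed.

Lemma closed_itv_closed (R : realType) (lo hi : \bar R) : closed (closed_itv lo hi).
Proof.
have -> : closed_itv lo hi =
    [set y | (lo <= y%:E)%E] `&` [set y | (y%:E <= hi)%E].
  by apply/seteqP; split => y; [case/andP|move=> [? ?]; apply/andP].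
apply: closedI.
  case: lo => [l||].
  - by rewrite (_ : mkset _ = [set y | l <= y]) //; exact: closed_ge.
  - rewrite (_ : mkset _ = set0); first exact: closed0.
    by apply/seteqP; split=> y.
  - rewrite (_ : mkset _ = setT); first exact: closedT.
    by apply/seteqP; split=> y _ //=; rewrite leNye.
case: hi => [h||].
- by rewrite (_ : mkset _ = [set y | y <= h]) //; exact: closed_le.
- rewrite (_ : mkset _ = setT); first exact: closedT.
  by apply/seteqP; split=> y _ //=; rewrite leey.
- rewrite (_ : mkset _ = set0); first exact: closed0.
  by apply/seteqP; split=> y.
Qed.

(** For a half-line the midpoint equation is false, and on the whole line membership is trivial;
    only finite endpoints need a computation. *)
Lemma closed_itv_reflection (R : realType) (lo hi : \bar R) (c y : R) :
  is_midpoint lo hi c -> closed_itv lo hi y -> closed_itv lo hi (c + c - y).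
Proof.
rewrite /is_midpoint /closed_itv /=.
case: lo => [l||]; case: hi => [h||] //=; rewrite ?lee_fin ?leNye ?leey //.
move=> /eqP; rewrite eqe => /eqP mid; lra.
Qed.

Lemma reflection_symmetricP (R : realType) (c : R) (A : set R) :
  (forall y, A y -> A (c + c - y)) -> reflection_symmetric c A.
Proof.
move=> H; apply/seteqP; split=> [_ [y Ay <-]|y Ay]; first exact: H.
by exists (c + c - y); [exact: H|ring].
Qed.

(** * Closedness, convex hull and symmetry *)

Lemma cvg_parts_abs (R : realType) (x : R^nat) (P Q : R) :
  series (pos_part x) @ \oo --> P -> series (neg_part x) @ \oo --> Q ->
  series (fun k => `|x k|) @ \oo --> P + Q.
Proof. by move=> xP xQ; apply: cvg_series_add xP xQ _ => k; exact: parts_add. Qed.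

Lemma cvg_or_divergent_parts (R : realType) (x : R^nat) :
  (exists P Q : R, series (pos_part x) @ \oo --> P /\ series (neg_part x) @ \oo --> Q) \/
  (~ cvgn (series (pos_part x)) \/ ~ cvgn (series (neg_part x))) /\
  (\sum_(0 <= k <oo) `|x k|%:E = +oo)%E.
Proof.
have x0 k : 0 <= `|x k| by [].
have [[B xB]|[nx ->]] := nneseries_cvg_or_pinfty x0; [left|right].
  have /cvg_ex [P xP] : cvgn (series (pos_part x)).
    apply: nonneg_series_cvg_le xB => k.
    by rewrite pos_part_ge0 parts_add lerDl neg_part_ge0.
  have /cvg_ex [Q xQ] : cvgn (series (neg_part x)).
    apply: nonneg_series_cvg_le xB => k.
    by rewrite neg_part_ge0 parts_add lerDr pos_part_ge0.
  by exists P, Q.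
split=> //; apply: contrapT => /not_orP [/contrapT /cvg_ex [P xP] /contrapT /cvg_ex [Q xQ]].
by apply: nx; apply/cvg_ex; exists (P + Q); exact: cvg_parts_abs.
Qed.

Lemma subsum_set_closed (R : realType) (x : R^nat) : x @ \oo --> (0 : R) ->
  closed (subsum_set x).
Proof.
move=> x0; case: (cvg_or_divergent_parts x) => [[P [Q [xP xQ]]]|[npq _]].
  have -> : subsum_set x = (fun y => y + Q) @^-1` subsum_set (fun k => `|x k|).
    by apply/seteqP; split=> y /(subsum_abs _ xQ).
  apply: closed_comp => [y _|].
    by apply: cvgD; [exact: cvg_id|exact: cvg_cst].
  exact: subsum_closed (cvg_parts_abs xP xQ).
rewrite (subsum_divergent x0 npq); exact: closed_itv_closed.
Qed.

Lemma subsum_convex_hull (R : realType) (x : R^nat) : x @ \oo --> (0 : R) ->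
  convex_hull (subsum_set x) = closed_itv (neg_sum x) (pos_sum x).
Proof.
move=> x0; case: (cvg_or_divergent_parts x) => [[P [Q [xP xQ]]]|[npq _]]; last first.
  by apply: convex_hull_closed_itv; rewrite (subsum_divergent x0 npq); [|left].
rewrite pos_sumE neg_sumE.
rewrite ((nneseries_cvgE P (pos_part_ge0 x)).2 xP).
rewrite ((nneseries_cvgE Q (neg_part_ge0 x)).2 xQ).
apply: convex_hull_closed_itv.
  move=> y xy; rewrite /closed_itv /= !lee_fin.
  by rewrite (subsum_ge_neg xQ xy) (subsum_le_pos xP xy).
right; exists (- Q), P; split=> //.
  rewrite -sub0r; apply: subsum_of_parts; [exact: subsum0|exact: subsum_total xQ].
rewrite -(subr0 P); apply: subsum_of_parts; [exact: subsum_total xP|exact: subsum0].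
Qed.

Lemma subsum_symmetric (R : realType) (x : R^nat) (c : R) : x @ \oo --> (0 : R) ->
  is_midpoint (neg_sum x) (pos_sum x) c -> reflection_symmetric c (subsum_set x).
Proof.
move=> x0; case: (cvg_or_divergent_parts x) => [[P [Q [xP xQ]]]|[npq _]] mid;
  apply: reflection_symmetricP => y; last first.
  by rewrite (subsum_divergent x0 npq); exact: closed_itv_reflection.
move: mid; rewrite pos_sumE neg_sumE /is_midpoint.
rewrite ((nneseries_cvgE P (pos_part_ge0 x)).2 xP).
rewrite ((nneseries_cvgE Q (neg_part_ge0 x)).2 xQ) /=.
move=> /eqP; rewrite eqe => /eqP mid.
rewrite (_ : c + c = P - Q); last lra.
by apply: subsum_refl; apply: cvg_series_sub xP xQ _ => k; exact: parts_sub.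
Qed.

(** * Transfer from the absolute values to the original sequence *)

Lemma separated_translate (R : realType) (A D : set R) (c : R) (m : nat) :
  (forall y, D y <-> A (y + c)) -> gap_separated A m -> gap_separated D m.
Proof.
move=> DA [f [fA fgap]]; exists (fun i => f i - c); split.
  by move=> i im; apply/DA; rewrite subrK; exact: fA.
move=> i j ij; have [z zf zA] := fgap i j ij.
by exists (z - c); [lra|rewrite DA subrK].
Qed.

(** The [2 ^ K] translates of one interval may overlap and are merged into disjoint ones; separated
    points bound their number from below. *)
Lemma subsum_union_of_itvs (R : realType) (x a : R^nat) (B c : R) (K : nat) :
  (forall k, 0 <= a k) -> series a @ \oo --> B -> (forall k, a k.+1 <= a k) ->
  (forall y, subsum_set x y <-> subsum_set a (y + c)) ->
  (forall k, (K <= k)%N -> a k <= remainder a B k.+1) ->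
  exists2 n, (2 ^ (\sum_(0 <= k < K) (remainder a B k.+1 < a k)%R) <= n <= 2 ^ K)%N &
    union_of_closed_itvs (subsum_set x) n.
Proof.
move=> a0 aB adec xa aK; have r0 := remainder_ge0 K a0 aB.
pose f i := nth 0 (partial_sums a K) i - c.
have [||n nK xn] := @disjoint_union_of_itvs _ (subsum_set x) f
    (fun i => f i + remainder a B K) (2 ^ K).
- by move=> i _; rewrite lerDl.
- move=> y; rewrite xa (subsum_split a K); split=> [[g gF gy]|[i iK yi]].
    have gK : (index g (partial_sums a K) < 2 ^ K)%N.
      by rewrite -(size_partial_sums a) index_mem.
    exists (index g (partial_sums a K)) => //; rewrite /f nth_index //.
    have := subsum_bounds (tail_terms_ge0 K a0) (cvg_tail_terms aB) gy; lra.
  exists (nth 0 (partial_sums a K) i); first by rewrite mem_nth ?size_partial_sums.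
  by apply: tail_subsum_full a0 aB aK _ _; move: yi; rewrite /f; lra.
exists n => //; rewrite nK andbT; apply: separated_card_le xn.
exact: separated_translate xa (separated_exceeding K a0 aB adec).
Qed.

Lemma subsum_compact (R : realType) (x a : R^nat) (B c : R) :
  (forall k, 0 <= a k) -> series a @ \oo --> B ->
  (forall y, subsum_set x y <-> subsum_set a (y + c)) ->
  closed (subsum_set x) -> compact (subsum_set x).
Proof.
move=> a0 aB xa xcl; apply: (@bounded_closed_subset_compact _ _ (- c) (B - c)) => //.
by move=> y /xa /(subsum_bounds a0 aB); lra.
Qed.

Lemma subsum_Cantor_or_Cantorval (R : realType) (x a : R^nat) (B c : R) :
  (forall k, 0 <= a k) -> series a @ \oo --> B -> (forall k, a k.+1 <= a k) ->
  (forall y, subsum_set x y <-> subsum_set a (y + c)) ->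
  perfect_set (subsum_set x) -> exceeds_often a B ->
  Cantor_set (subsum_set x) \/ symmetric_Cantorval (subsum_set x).
Proof.
move=> a0 aB adec xa xperf aex; have xcl := xperf.1.
have x0 : subsum_set x !=set0 by exists 0; exact: subsum0.
have [td|] := pselect (totally_disconnected (subsum_set x)).
  by left; split=> //; exact: subsum_compact a0 aB xa xcl.
move=> /not_totally_disconnected_segment [p [q [pq pqx]]]; right.
apply: (@Cantorval_of_gaps _ _ (- c) (B - c)) => //.
- by move=> y /xa /(subsum_bounds a0 aB); lra.
- move=> y e /xa ay e0.
  have pqc : p + c < q + c by lra.
  have [|p' [q' [h1 h2 h3 pqx']]] := subsum_segment_near a0 aB pqc _ ay e0.
    by move=> z zpq; rewrite -(subrK c z); apply/xa/pqx; lra.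
  exists (p' - c), (q' - c); split; try lra.
  by move=> z zpq; apply/xa/pqx'; lra.
- move=> z v zv /xa av gap w vw.
  have zvc : z + c < v + c by lra.
  have [||p' pvw ap] := subsum_gap_right a0 aB adec aex zvc av _ (w := w + c).
  + by move=> u uv; rewrite -(subrK c u) => /xa; apply: gap; lra.
  + by lra.
  by exists (p' - c); [lra|rewrite xa subrK].
- move=> z v vz /xa av gap w wv.
  have vzc : v + c < z + c by lra.
  have [||p' pvw ap] := subsum_gap_left a0 aB adec aex vzc av _ (w := w + c).
  + by move=> u uv; rewrite -(subrK c u) => /xa; apply: gap; lra.
  + by lra.
  by exists (p' - c); [lra|rewrite xa subrK].
Qed.

Lemma subsum_Cantor (R : realType) (x a : R^nat) (B c : R) :
  (forall k, 0 <= a k) -> series a @ \oo --> B ->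
  (forall y, subsum_set x y <-> subsum_set a (y + c)) ->
  perfect_set (subsum_set x) -> (forall k, remainder a B k.+1 < a k) ->
  Cantor_set (subsum_set x).
Proof.
move=> a0 aB xa xperf aex; split=> //.
- by exists 0; exact: subsum0.
- exact: subsum_compact a0 aB xa xperf.1.
apply: no_segment_totally_disconnected => p q pq.
have pqc : p + c < q + c by lra.
have [z zpq az] := subsum_no_segment a0 aB aex pqc.
by exists (z - c); [lra|rewrite xa subrK].
Qed.

Theorem theorem6p2 (R : realType) (x : R^nat) (x_null : x @ \oo --> (0 : R)) :
  [/\ closed (subsum_set x),
      infinite_set [set k | x k != 0] -> perfect_set (subsum_set x),
      convex_hull (subsum_set x) = closed_itv (neg_sum x) (pos_sum x) &
      forall c : R, is_midpoint (neg_sum x) (pos_sum x) c ->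
        reflection_symmetric c (subsum_set x)]
  /\
  forall sigma : nat -> nat, term_indexing x sigma ->
    let a := abs_terms x sigma in
    (forall k, a k.+1 <= a k) ->
    [/\ forall K N : nat,
          (forall k, (K <= k)%N -> ((a k)%:E <= tail a k)%E) ->
          (exceeding a #= `I_N)%card ->
          exists2 n : nat, (2 ^ N <= n <= 2 ^ K)%N &
            union_of_closed_itvs (subsum_set x) n,
        infinite_set (exceeding a) ->
          Cantor_set (subsum_set x) \/ symmetric_Cantorval (subsum_set x) &
        (forall k, (tail a k < (a k)%:E)%E) -> Cantor_set (subsum_set x)].
Proof.
have xcl := subsum_set_closed x_null.
split; first split=> //.
- by move=> xinf; exact: subsum_perfect.
- exact: subsum_convex_hull.
- by move=> c; exact: subsum_symmetric.
move=> sigma [sinj srange] a adec.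
have a0 k : 0 <= a k by exact: normr_ge0.
have srange' : [set k | `|x k| != 0] `<=` range sigma.
  by move=> k /=; rewrite normr_eq0; exact: srange.
have x0 k : 0 <= `|x k| by [].
have asum := nneseries_reindex x0 sinj srange'.
have [[P [Q [xP xQ]]]|[npq xoo]] := cvg_or_divergent_parts x; last first.
  (* All tails are infinite, so no term exceeds its tail: [N] is 0 and a single interval
     suffices. *)
  have ex0 : exceeding a = set0.
    apply/seteqP; split=> // k.
    by rewrite /exceeding /= tail_pinfty // -?asum // ltNge leey.
  split; last by move=> /(_ 0%N); rewrite tail_pinfty // -?asum // ltNge leey.
    move=> K N _; rewrite ex0 -II0 => /card_eq_II <-.
    exists 1%N; first by rewrite expn0 leqnn expn_gt0.
    exists (fun=> neg_sum x), (fun=> pos_sum x); rewrite -(subsum_divergent x_null npq).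
    split.
    - by move=> i _; exists 0; exact: subsum0.
    - by move=> i j /=; rewrite !ltnS !leqn0 => /eqP -> /eqP ->.
    - apply/seteqP; split=> y; first by exists 0%N.
      by case.
  by rewrite ex0 => /(_ (finite_set0 _)).
have aB : series a @ \oo --> P + Q.
  apply/nneseries_cvgE => //; rewrite -asum; apply/nneseries_cvgE => //.
  exact: cvg_parts_abs.
have xa y : subsum_set x y <-> subsum_set a (y + Q).
  by rewrite (subsum_abs y xQ) (subsum_reindex x0 sinj srange').
have tailE k : tail a k = (remainder a (P + Q) k.+1)%:E by exact: tail_cvgE.
(* Terms exceeding their tails are positive; if they occur arbitrarily late, monotonicity makes
   every [a k] positive, so [x] has infinitely many nonzero terms. *)
have aex_perfect : exceeds_often a (P + Q) -> perfect_set (subsum_set x).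
  move=> aex; apply: subsum_perfect => // xfin.
  suff : finite_set [set: nat] by exact: infinite_nat.
  have := finite_preimage (f := sigma) (in2W sinj) xfin.
  apply: sub_finite_set => k _ /=; rewrite -normr_eq0.
  have [m km am] := aex k.
  have am0 : 0 < a m by apply: le_lt_trans am; exact: remainder_ge0.
  apply: lt0r_neq0; apply: lt_le_trans am0 _.
  by move/nonincreasing_seqP : adec => /(_ k m km).
split.
- move=> K N aK exN.
  have aK' k : (K <= k)%N -> a k <= remainder a (P + Q) k.+1.
    by move=> /aK; rewrite tailE lee_fin.
  suff <- : (\sum_(0 <= k < K) (remainder a (P + Q) k.+1 < a k)%R)%N = N.
    exact: subsum_union_of_itvs a0 aB adec xa aK'.
  (* No term of index [K] or more exceeds its tail, so counting below [K] counts all. *)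
  apply: card_bounded_pred; rewrite (_ : mkset _ = exceeding a) //.
  apply/seteqP; split => k; rewrite /exceeding /= tailE lte_fin; first by case/andP.
  move=> exk; rewrite exk andbT ltnNge; apply/negP => /aK'.
  by rewrite leNgt exk.
- move=> exinf.
  have aex : exceeds_often a (P + Q).
    move=> n; apply: contrapT => H; apply: exinf.
    apply: (sub_finite_set (B := `I_n)); last exact: finite_II.
    move=> k; rewrite /exceeding /= tailE lte_fin => exk.
    by rewrite ltnNge; apply/negP => nk; apply: H; exists k.
  exact: subsum_Cantor_or_Cantorval a0 aB adec xa (aex_perfect aex) aex.
- move=> ex.
  have ex' k : remainder a (P + Q) k.+1 < a k by have := ex k; rewrite tailE lte_fin.
  have aex : exceeds_often a (P + Q) by move=> n; exists n.
  exact: subsum_Cantor a0 aB xa (aex_perfect aex) ex'.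
Qed.
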